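(* For every $r\ge1$ and every $n\ge1$, $$D_r(n;z)=[u^{r-1}]\prod_{q=1}^n\left(1+z\,\frac{e^{u/q}-1}{u}\right).$$
   Context: For a partition $\mu=(\mu_1,\ldots,\mu_i)$, $\mu\vdash j$ means $\mu_1+\cdots+\mu_i=j$ and $\ell(\mu)=i$ is the number of positive parts. $m_\mu(x_1,\ldots,x_n)$ is the monomial symmetric polynomial: the sum of all distinct monomials obtained by assigning the exponents $\mu_1,\ldots,\mu_i$ to distinct variables among $x_1,\ldots,x_n$ ($0$ if $i>n$). For $n\ge1$, $$E_{i,j}(n)=\sum_{\mu\vdash j,\ \ell(\mu)=i}\frac{m_\mu(1,1/2,\ldots,1/n)}{\mu_1!\cdots\mu_i!},\qquad E_{0,0}(n)=1,$$ with empty sums equal to $0$, and for $r\ge1$ $$D_r(n;z)=\sum_{i\ge0}E_{i,i+r-1}(n)\,z^i.$$ $(e^{u/q}-1)/u$ is regarded as a power series in $u$ (with value $1/q$ at $u=0$), and $[u^{r-1}]$ denotes the coefficient of $u^{r-1}$. *)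

(* Defs.v *)
From HB Require Import structures.
From mathcomp Require Import all_boot all_order all_algebra.
From mathcomp Require Import boolp.
From mathcomp.multinomials Require Import mpoly.

Set Implicit Arguments.
Unset Strict Implicit.
Unset Printing Implicit Defensive.

Import GRing.Theory.
Local Open Scope ring_scope.

(* [fps R] is R[[X]]; the series [Fps c] has [c k] as the coefficient of X^k.
   A record (and not [nat -> R] itself) keeps the Cauchy product apart from the
   pointwise ring structure on functions. *)
Record fps (R : Type) := Fps { fps_coef : nat -> R }.
Arguments Fps {R} _.
Arguments fps_coef {R} _ _.

HB.instance Definition _ (R : Type) := gen_eqMixin (fps R).
HB.instance Definition _ (R : Type) := gen_choiceMixin (fps R).

Lemma fpsP (R : Type) (s t : fps R) :
  (forall k, fps_coef s k = fps_coef t k) -> s = t.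
Proof. by case: s t => [s] [t] /= st; congr Fps; apply: funext. Qed.

Section FpsZmodule.
Variable R : zmodType.
Implicit Types s t : fps R.

Definition fps_zero : fps R := Fps (fun=> 0).
Definition fps_opp s : fps R := Fps (fun k => - fps_coef s k).
Definition fps_add s t : fps R := Fps (fun k => fps_coef s k + fps_coef t k).

Fact fps_addA : associative fps_add.
Proof. by move=> s t v; apply: fpsP => k /=; rewrite addrA. Qed.
Fact fps_addC : commutative fps_add.
Proof. by move=> s t; apply: fpsP => k /=; rewrite addrC. Qed.
Fact fps_add0 : left_id fps_zero fps_add.
Proof. by move=> s; apply: fpsP => k /=; rewrite add0r. Qed.
Fact fps_addN : left_inverse fps_zero fps_opp fps_add.
Proof. by move=> s; apply: fpsP => k /=; rewrite addNr. Qed.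

HB.instance Definition _ :=
  GRing.isZmodule.Build (fps R) fps_addA fps_addC fps_add0 fps_addN.

End FpsZmodule.

Section FpsRing.
Variable R : comNzRingType.
Implicit Types s t v : fps R.

Definition fpsC (c : R) : fps R := Fps (fun k => if k == 0%N then c else 0).

Definition fps_mul s t : fps R :=
  Fps (fun k => \sum_(i < k.+1) fps_coef s i * fps_coef t (k - i)).

Let tr m s : {poly R} := \poly_(i < m) fps_coef s i.

Let tr_mul m s t k : (k < m)%N ->
  (tr m s * tr m t)`_k = fps_coef (fps_mul s t) k.
Proof.
move=> km; rewrite coefM /=; apply: eq_bigr => i _.
by rewrite !coef_poly (leq_ltn_trans (leq_ord i) km)
           (leq_ltn_trans (leq_subr i k) km).
Qed.

Let coef_mul_low (p q p' q' : {poly R}) k :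
  (forall i, (i <= k)%N -> p`_i = p'`_i) ->
  (forall i, (i <= k)%N -> q`_i = q'`_i) -> (p * q)`_k = (p' * q')`_k.
Proof.
move=> pp qq; rewrite !coefM; apply: eq_bigr => i _.
by rewrite pp ?leq_ord // qq // leq_subr.
Qed.

Let tr_fps_mul s t k i : (i <= k)%N ->
  (tr k.+1 (fps_mul s t))`_i = (tr k.+1 s * tr k.+1 t)`_i.
Proof. by move=> ik; rewrite (@tr_mul k.+1) ?ltnS // coef_poly ltnS ik. Qed.

Fact fps_mulC : commutative fps_mul.
Proof.
by move=> s t; apply: fpsP => k; rewrite -!(@tr_mul k.+1) // mulrC.
Qed.
Fact fps_mulA : associative fps_mul.
Proof.
move=> s t v; apply: fpsP => k; rewrite -!(@tr_mul k.+1) //.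
transitivity ((tr k.+1 s * (tr k.+1 t * tr k.+1 v))`_k).
  by apply: coef_mul_low => // i ik; rewrite tr_fps_mul.
by rewrite mulrA; apply: coef_mul_low => // i ik; rewrite tr_fps_mul.
Qed.
Fact fps_mul1 : left_id (fpsC 1) fps_mul.
Proof.
move=> s; apply: fpsP => k /=; rewrite big_ord_recl /= mul1r subn0.
by rewrite big1 ?addr0 // => i _; rewrite mul0r.
Qed.
Fact fps_mulDl : left_distributive fps_mul (@fps_add R).
Proof.
move=> s t v; apply: fpsP => k /=; rewrite -big_split /=.
by apply: eq_bigr => i _; rewrite mulrDl.
Qed.
Fact fps_1neq0 : fpsC 1 != 0.
Proof.
by apply/eqP => /(congr1 (fun s => fps_coef s 0)) /= /eqP; rewrite oner_eq0.
Qed.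

HB.instance Definition _ := GRing.Zmodule_isComNzRing.Build (fps R)
  fps_mulA fps_mulC fps_mul1 fps_mulDl fps_1neq0.

Definition fpsX : fps R := Fps (fun k => (k == 1%N)%:R).

(* The quotient by X; only meaningful when s has no constant term, see
   [fps_divXK]. *)
Definition fps_divX s : fps R := Fps (fun k => fps_coef s k.+1).

Lemma fps_divXK s : fps_coef s 0 = 0 -> fpsX * fps_divX s = s.
Proof.
move=> s0; apply: fpsP => -[|k] /=.
  by rewrite big_ord_recl big_ord0 /= mul0r addr0 s0.
rewrite 2!big_ord_recl /= mul0r add0r mul1r big1 ?addr0 ?subn1 //.
by move=> i _; rewrite mul0r.
Qed.

End FpsRing.

Definition fps_map (R S : Type) (f : R -> S) (s : fps R) : fps S :=
  Fps (fun k => f (fps_coef s k)).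

(* e^{aX} *)
Definition fps_exp (a : rat) : fps rat := Fps (fun k => a ^+ k / k`!%:R).

Definition is_partition (j : nat) (mu : seq nat) : bool :=
  [&& sorted geq mu, 0%N \notin mu & sumn mu == j].

(* The monomial in n variables obtained by assigning the exponent mu_p to the
   variable of index f p (for each p), when f is injective. *)
Definition assign_exponents (n : nat) (mu : seq nat)
    (f : {ffun 'I_(size mu) -> 'I_n}) : 'X_{1..n} :=
  [multinom (\sum_(p < size mu | f p == q) nth 0 mu p)%N | q < n].

(* Equal parts of mu make different f yield the same monomial, whence [undup]:
   each monomial is counted once. *)
Definition monomial_sym (n : nat) (mu : seq nat) : {mpoly rat[n]} :=
  \sum_(m <- undup [seq assign_exponents f |
                     f <- enum [pred f : {ffun 'I_(size mu) -> 'I_n} |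
                                 injectiveb f]])
    'X_[m].

(* The variables x_1, ..., x_n are indexed from 0, so x_{k+1} := 1/(k+1).
   A partition of j with i parts is an i-tuple of numbers <= j. *)
Definition E (i j n : nat) : rat :=
  \sum_(mu : i.-tuple 'I_j.+1 | is_partition j (map val mu))
    (monomial_sym n (map val mu)).@[fun k : 'I_n => k.+1%:R^-1]
      / (\prod_(p <- map val mu) p`!)%N%:R.

(* The sum over all i >= 0 is a formal power series in z. *)
Definition D (r n : nat) : fps rat := Fps (fun i => E i (i + r - 1) n).

(* (e^{u/q} - 1)/u as a formal power series in u. *)
Definition exp_quot (q : nat) : fps rat := fps_divX (fps_exp q%:R^-1 - 1).

(* Main.v *)
Require Import Defs.
From mathcomp Require Import all_boot all_order all_algebra.
From mathcomp.multinomials Require Import mpoly.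

(** Both sides are the same sum over exponent vectors.  Write x_q = 1/q and,
    for f : {1, ..., n} -> nat, let w f be the product of the
    x_q ^ f q / (f q)!.

    On the left, m_mu is a sum of monomials, one for each vector f whose
    multiset of nonzero values is mu, and mu_1! ... mu_i! is the product of all
    the (f q)! because 0! = 1.  Each f of total j with a support of size i
    occurs for exactly one partition mu of j with i parts, so E i j n is the sum
    of w f over all such f ([E_sum]).

    On the right, expand the product over q into a sum over the set J of those
    q where the term in z is picked: the coefficient of z^i retains the J of
    size i, with the product of the (e^(u/q) - 1)/u over q in J
    ([coef_prod_1Dz]).  Multiplying that product by u^i turns it into the
    product of the e^(u/q) - 1, whose terms are the w f u^(sum f) with f of
    support exactly J, since e^(u/q) - 1 lacks only the constant term of
    e^(u/q) ([coef_prod_exp_quot]).  The coefficient of u^(r - 1) thus collects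
    the f of total i + r - 1, and summing over J gives [E_sum] again. *)

Set Implicit Arguments.
Unset Strict Implicit.
Unset Printing Implicit Defensive.

Import GRing.Theory.
Local Open Scope ring_scope.

(** * Coefficients of sums and products of power series *)

Lemma fps_coef_sum (R : zmodType) (I : Type) (r : seq I) (P : pred I)
    (F : I -> fps R) k :
  fps_coef (\sum_(i <- r | P i) F i) k = \sum_(i <- r | P i) fps_coef (F i) k.
Proof. exact: (big_morph (fun s => fps_coef s k)). Qed.

(** The Cauchy product over a finite family: one index f i is chosen in each
    factor.  Only indices at most k can contribute, so any bound K > k on them
    keeps the sum finite; leaving K free lets all the exponent vectors below
    live in the same type.  The proof passes to the truncations below degree K,
    which are polynomials, where the expansion is distributivity. *)
Lemma fps_coef_prod (R : comNzRingType) (I : finType) (F : I -> fps R) K k :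
  (k < K)%N ->
  fps_coef (\prod_i F i) k =
  \sum_(f : {ffun I -> 'I_K} | (\sum_i f i == k)%N)
     \prod_i fps_coef (F i) (f i).
Proof.
move=> kK; pose T (s : fps R) : {poly R} := \poly_(a < K) fps_coef s a.
pose agree (s : fps R) (p : {poly R}) :=
  forall a, (a < K)%N -> fps_coef s a = p`_a.
have -> : fps_coef (\prod_i F i) k = (\prod_i T (F i))`_k.
  suff: agree (\prod_i F i) (\prod_i T (F i)) by apply.
  apply: (big_ind2 agree) => [a _|s p t q sp tq a aK|i _ a aK].
  - by rewrite coef1 /=; case: eqP.
  - rewrite coefM; apply: eq_bigr => b _.
    by rewrite sp ?tq // (leq_ltn_trans _ aK) ?leq_ord ?leq_subr.
  - by rewrite coef_poly aK.
under eq_bigr => i _ do rewrite /T poly_def.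
rewrite bigA_distr_bigA coef_sum [RHS]big_mkcond; apply: eq_bigr => f _ /=.
rewrite scaler_prod prodrXr coefZ coefXn eq_sym.
by case: eqP => _; rewrite ?mulr1 ?mulr0.
Qed.

Lemma fps_coef_Xn_mul (R : comNzRingType) (s : fps R) m k :
  fps_coef (fpsX R ^+ m * s) (k + m) = fps_coef s k.
Proof.
elim: m s => [|m IHm] s; first by rewrite mul1r addn0.
rewrite exprSr -mulrA addnS -[RHS](IHm s).
have shift t a : fps_coef (fpsX R * t) a.+1 = fps_coef t a.
  rewrite /= 2!big_ord_recl /= mul0r add0r mul1r big1 ?addr0 ?subn1 //.
  by move=> i _; rewrite mul0r.
by rewrite mulrCA shift.
Qed.

Lemma fpsCM (R : comNzRingType) : {morph @fpsC R : a b / a * b}.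
Proof.
move=> a b; apply: fpsP => -[|k] /=; first by rewrite big_ord1.
by rewrite big1 // => i _; case: (i : nat) => [|m]; rewrite /= ?mul0r ?mulr0.
Qed.

Lemma fpsC_coefM (R : comNzRingType) (a : R) s k :
  fps_coef (fpsC a * s) k = a * fps_coef s k.
Proof.
by rewrite /= big_ord_recl /= subn0 big1 ?addr0 // => i _; rewrite mul0r.
Qed.

Lemma fps_map_fpsCM (R : comNzRingType) :
  {morph fps_map (@fpsC R) : s t / s * t}.
Proof.
move=> s t; apply: fpsP => k /=.
rewrite (big_morph (@fpsC R) (id1 := 0) (op1 := +%R)).
- by apply: eq_bigr => i _; rewrite fpsCM.
- by move=> a b; apply: fpsP => -[|m] /=; rewrite ?addr0.
- by apply: fpsP => -[|m].
Qed.

Lemma fps_map_fpsC1 (R : comNzRingType) : fps_map (@fpsC R) 1 = 1.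
Proof. by apply: fpsP => -[|k] //=; apply: fpsP => -[|m]. Qed.

Lemma fpsX_exp_coef (R : comNzRingType) m k :
  fps_coef (fpsX R ^+ m) k = (k == m)%:R.
Proof.
elim: m k => [|m IHm] [|k]; rewrite ?expr0 //; rewrite exprS.
  by rewrite /= big_ord1 mul0r.
rewrite -[k.+1]addn1 -[X in X * _]expr1 fps_coef_Xn_mul IHm.
by rewrite addn1 eqSS.
Qed.

(** * The product side *)

(** The factors with q in J contribute z, so that a set J yields z^#|J| times a
    series in u alone. *)
Lemma coef_prod_1Dz (n i k : nat) (g : 'I_n -> fps rat) :
  fps_coef (fps_coef (\prod_q (1 + fpsC (fpsX rat) * fps_map (@fpsC rat) (g q)))
     k) i =
  \sum_(J : {set 'I_n} | #|J| == i) fps_coef (\prod_(q in J) g q) k.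
Proof.
under eq_bigr => q _ do rewrite addrC.
rewrite bigA_distr !fps_coef_sum [RHS]big_mkcond; apply: eq_bigr => J _.
rewrite -big_mkcond big_split prodr_const.
rewrite -(big_morph _ (@fps_map_fpsCM rat) (fps_map_fpsC1 rat)).
have -> : fpsC (fpsX rat) ^+ #|J| = fpsC (fpsX rat ^+ #|J|).
  by elim: #|J| => // m IHm; rewrite !exprS IHm fpsCM.
rewrite fpsC_coefM mulrC fpsC_coefM fpsX_exp_coef eq_sym.
by case: eqP => _; rewrite ?mulr1 ?mulr0.
Qed.

Definition support_set {n K : nat} (f : {ffun 'I_n -> 'I_K}) : {set 'I_n} :=
  [set q | f q != 0%N :> nat].

(** Clearing the #|J| denominators u shifts the degree from k to k + #|J|; the
    factors are then e^(u/(q+1)) - 1 for q in J (the variables being numbered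
    from 0) and 1 for q outside J.  A vector f
    survives exactly when f q is nonzero on J (no constant term) and zero off J
    (only a constant term). *)
Lemma coef_prod_exp_quot (n k : nat) (J : {set 'I_n}) K : (k + #|J| < K)%N ->
  fps_coef (\prod_(q in J) exp_quot q.+1) k =
  \sum_(f : {ffun 'I_n -> 'I_K} |
          (\sum_q f q == k + #|J|)%N && (support_set f == J))
     \prod_(q < n) (q.+1%:R^-1 ^+ f q / (f q)`!%:R).
Proof.
move=> kK; rewrite -(fps_coef_Xn_mul _ #|J|) -prodr_const -big_split /=.
have exp0 q : fps_coef (fps_exp q.+1%:R^-1 - 1) 0 = 0.
  by rewrite /= fact0 divr1 subrr.
rewrite (eq_bigr (fun q : 'I_n => fps_exp q.+1%:R^-1 - 1)); last first.
  by move=> q _; apply: fps_divXK.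
rewrite big_mkcond (@fps_coef_prod _ _ _ K) //= big_mkcondr.
apply: eq_bigr => f _; case: eqP => [<-|/eqP/negP neJ].
  apply: eq_bigr => q _; rewrite inE; case: eqP => /= [->|/eqP/negPf->] //=.
  by rewrite subr0.
(* At a q where the support of f and J differ, the factor vanishes. *)
have [q qJ] : exists q, (q \in support_set f) != (q \in J).
  apply/existsP; apply: contra_notT neJ; rewrite negb_exists => /forallP e.
  by apply/eqP/setP => q; apply/eqP; rewrite -[_ == _]negbK e.
rewrite (bigD1 q) //= (_ : fps_coef _ _ = 0) ?mul0r //.
move: qJ; rewrite inE; case: (q \in J) => /=; rewrite ?eqb_id ?eqbF_neg ?negbK.
  by move/eqP => ->; apply: exp0.
by move=> /negPf->.
Qed.

(** * Monomial symmetric polynomials as sums over exponent vectors *)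

Definition parts {n : nat} (m : 'I_n -> nat) : seq nat :=
  [seq m q | q <- enum 'I_n & m q != 0%N].

Lemma assign_exponentsE n (mu : seq nat) (g : {ffun 'I_(size mu) -> 'I_n}) :
  injective g -> forall p, assign_exponents g (g p) = nth 0%N mu p.
Proof.
move=> inj p; rewrite mnmE (big_pred1 p) // => p'.
by rewrite /= (inj_eq inj).
Qed.

Lemma assign_exponents_out n (mu : seq nat) (g : {ffun 'I_(size mu) -> 'I_n}) q :
  q \notin codom g -> assign_exponents g q = 0%N.
Proof.
move=> qg; rewrite mnmE big_pred0 // => p; apply: contraNF qg => /eqP <-.
exact: codom_f.
Qed.

Lemma parts_assign_exponents n (mu : seq nat) (g : {ffun 'I_(size mu) -> 'I_n}) :
  0%N \notin mu -> injective g -> perm_eq (parts (assign_exponents g)) mu.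
Proof.
move=> mu0 inj; have := map_nth_iota0 0%N (leqnn (size mu)); rewrite take_size.
rewrite -val_enum_ord -map_comp => mapmu.
rewrite -[X in perm_eq _ X]mapmu.
under [X in perm_eq _ X]eq_map => p do rewrite /= -(assign_exponentsE inj).
rewrite (map_comp (assign_exponents g) g).
apply/perm_map/uniq_perm; rewrite ?map_inj_uniq ?filter_uniq -?enumT ?enum_uniq //.
move=> q; rewrite mem_filter mem_enum andbT.
have [/codomP[p ->]|qg] := boolP (q \in codom g).
  rewrite (assign_exponentsE inj).
  by apply: contraNneq mu0 => <-; rewrite mem_nth.
by rewrite assign_exponents_out.
Qed.

(** Listing mu as a permutation of the nonzero exponents of m, each part of mu
    names the variable that carries it; distinct parts name distinct variables
    because the support s is listed without repetition. *)
Lemma assign_exponents_of_parts n (m : 'X_{1..n}) (mu : seq nat) :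
  perm_eq (parts m) mu ->
  exists2 g : {ffun 'I_(size mu) -> 'I_n}, injective g & m = assign_exponents g.
Proof.
rewrite perm_sym; set s := [seq q <- enum 'I_n | m q != 0%N].
have us : uniq s by rewrite filter_uniq ?enum_uniq.
move=> /(perm_iotaP 0%N)[Is perIs mapIs].
have szm : size mu = size Is by rewrite mapIs size_map.
have Is_lt p : (p < size mu)%N -> (nth 0%N Is p < size s)%N.
  move=> lp; have: nth 0%N Is p \in Is by rewrite mem_nth -?szm.
  by rewrite (perm_mem perIs) mem_iota /= size_map.
pose g := [ffun p : 'I_(size mu) =>
             tnth (in_tuple s) (Ordinal (Is_lt p (ltn_ord p)))].
have gE q0 p : g p = nth q0 s (nth 0%N Is p) by rewrite ffunE (tnth_nth q0).
have inj : injective g.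
  move=> p p' /eqP; rewrite (gE (g p)) (gE (g p) p') nth_uniq ?Is_lt //.
  rewrite nth_uniq -?szm //; first by move/eqP/val_inj.
  by rewrite (perm_uniq perIs) iota_uniq.
exists g => //; apply/mnmP => q.
have gm p : m (g p) = nth 0%N mu p.
  transitivity (nth 0%N (parts m) (nth 0%N Is p)).
    by rewrite (nth_map (g p)) -?gE // Is_lt.
  by rewrite [in RHS](congr1 (nth 0%N) mapIs) (nth_map 0%N) -?szm.
have [/codomP[p ->]|qg] := boolP (q \in codom g).
  by rewrite (assign_exponentsE inj) gm.
rewrite assign_exponents_out //; apply: contraNeq qg => mq.
have qs : q \in s by rewrite mem_filter mq mem_enum.
have iIs : index q s \in Is.
  by rewrite (perm_mem perIs) mem_iota /= size_map index_mem.
have lp : (index (index q s) Is < size mu)%N by rewrite szm index_mem.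
apply/codomP; exists (Ordinal lp).
by rewrite (gE q) /= nth_index // nth_index.
Qed.

Lemma mem_monomials n (mu : seq nat) (m : 'X_{1..n}) : 0%N \notin mu ->
  (m \in [seq assign_exponents f |
           f <- enum [pred f : {ffun 'I_(size mu) -> 'I_n} | injectiveb f]]) =
  perm_eq (parts m) mu.
Proof.
move=> mu0; apply/mapP/idP => [[g]|/assign_exponents_of_parts[g inj ->]].
  by rewrite mem_enum inE => /injectiveP inj ->; apply: parts_assign_exponents.
by exists g => //; rewrite mem_enum inE; apply/injectiveP.
Qed.

Lemma sumn_parts n (m : 'I_n -> nat) : sumn (parts m) = (\sum_q m q)%N.
Proof.
rewrite sumnE big_map big_filter big_mkcond /= big_enum /=.
by apply: eq_bigr => q _; case: eqP.
Qed.

Lemma size_parts n K (f : {ffun 'I_n -> 'I_K}) :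
  size (parts (fun q => f q)) = #|support_set f|.
Proof.
rewrite size_map size_filter -sum1_count -sum1_card big_enum_cond /=.
by apply: eq_bigl => q; rewrite inE.
Qed.

Lemma prod_fact_parts n (m : 'I_n -> nat) :
  (\prod_(p <- parts m) p`! = \prod_q (m q)`!)%N.
Proof.
rewrite big_map big_filter big_mkcond /= big_enum /=.
by apply: eq_bigr => q _; case: eqP => //= ->.
Qed.

Definition mnm_of_ffun {n K : nat} (f : {ffun 'I_n -> 'I_K}) : 'X_{1..n} :=
  [multinom f q : nat | q < n].

Lemma parts_mnm_of_ffun n K (f : {ffun 'I_n -> 'I_K}) :
  parts (mnm_of_ffun f) = parts (fun q => f q).
Proof.
rewrite /parts (eq_filter (a2 := fun q => f q != 0%N :> nat)).
  by apply: eq_map => q; rewrite mnmE.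
by move=> q; rewrite mnmE.
Qed.

(** A monomial whose exponents form mu has all its exponents at most j, so the
    finite type of vectors bounded by j contains them all. *)
Lemma monomial_sym_sum n j (mu : seq nat) : is_partition j mu ->
  monomial_sym n mu =
  \sum_(f : {ffun 'I_n -> 'I_j.+1} |
           perm_eq (parts (fun q => f q)) mu) 'X_[mnm_of_ffun f].
Proof.
case/and3P => _ mu0 /eqP summu; rewrite /monomial_sym.
rewrite -[RHS]big_filter -[RHS](big_map mnm_of_ffun xpredT (fun m => 'X_[m])).
apply: perm_big; apply: uniq_perm; rewrite ?undup_uniq //.
  rewrite map_inj_uniq ?filter_uniq ?index_enum_uniq // => f f' /mnmP eqf.
  by apply/ffunP => q; apply: val_inj; have := eqf q; rewrite !mnmE.
move=> m; rewrite mem_undup mem_monomials //; apply/idP/mapP => [pm|[f]].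
  have lem q : (m q < j.+1)%N.
    rewrite ltnS -summu -(perm_sumn pm) sumn_parts (bigD1 q) //=.
    exact: leq_addr.
  have mE : m = mnm_of_ffun [ffun q => Ordinal (lem q)].
    by apply/mnmP => q; rewrite mnmE ffunE.
  exists [ffun q => Ordinal (lem q)] => //.
  by rewrite mem_filter mem_index_enum andbT -parts_mnm_of_ffun -mE.
by rewrite mem_filter => /andP[pf _] ->; rewrite parts_mnm_of_ffun.
Qed.

(** The vectors are grouped by the partition formed by their nonzero values,
    listed in decreasing order. *)
Lemma E_sum i j n :
  E i j n = \sum_(f : {ffun 'I_n -> 'I_j.+1} |
                   (\sum_q f q == j)%N && (#|support_set f| == i))
              \prod_(q < n) (q.+1%:R^-1 ^+ f q / (f q)`!%:R).
Proof.
pose sparts (f : {ffun 'I_n -> 'I_j.+1}) : seq 'I_j.+1 :=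
  sort (relpre val geq)
    [seq f q | q <- enum 'I_n & f q != 0%N :> nat].
have val_sparts f : map val (sparts f) = sort geq (parts (fun q => f q)).
  by rewrite -sort_map -map_comp.
have geq_total : total geq by move=> a b; apply: leq_total.
have geq_trans : transitive geq by move=> a b c ba cb; apply: leq_trans cb ba.
have geq_anti : antisymmetric geq by move=> a b; rewrite andbC; apply: anti_leq.
(* The default value serves the vectors whose support does not have size i,
   which are absent from the sum. *)
pose mu_of f : i.-tuple 'I_j.+1 := insubd [tuple of nseq i ord0] (sparts f).
have parts0 (f : {ffun 'I_n -> 'I_j.+1}) : 0%N \notin parts (fun q => f q).
  by apply/mapP => -[q]; rewrite mem_filter => /andP[/eqP fq _] /esym.
have val_mu f : #|support_set f| == i ->
    map val (mu_of f) = sort geq (parts (fun q => f q)).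
  move=> si; rewrite val_insubd -size_parts in si *.
  by rewrite -(size_map val) val_sparts size_sort si val_sparts.
rewrite /E [RHS](partition_big mu_of
    (fun mu : i.-tuple 'I_j.+1 => is_partition j (map val mu))) /=; last first.
  move=> f /andP[sumf si]; rewrite val_mu //; apply/and3P; split.
  - exact: sort_sorted.
  - by rewrite mem_sort.
  - by rewrite (perm_sumn (permEl (perm_sort _ _))) sumn_parts.
apply: eq_bigr => mu pmu; rewrite (monomial_sym_sum n pmu) raddf_sum /= mulr_suml.
apply: eq_big => [f|f pf].
  have [smu mu0 /eqP summu] := and3P pmu; apply/idP/andP => [pf|[/andP[sumf si]]].
    have si : #|support_set f| == i.
      by rewrite -size_parts (perm_size pf) size_map size_tuple.
    split; first by rewrite si -sumn_parts (perm_sumn pf) summu eqxx.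
    apply/eqP/val_inj/(inj_map val_inj); rewrite val_mu //.
    apply: (sorted_eq geq_trans geq_anti) => //; first exact: sort_sorted.
    by rewrite perm_sort.
  by move=> /eqP <-; rewrite val_mu // perm_sym perm_sort.
rewrite mevalX -(perm_big _ pf) /= prod_fact_parts natr_prod -prodf_div.
by apply: eq_bigr => q _; rewrite mnmE.
Qed.

(** * The generating function identity *)

Unset Implicit Arguments.

(* The product is taken in (Q[[z]])[[u]] = fps (fps rat): the outer
   indeterminate is u, and z is the constant [fpsC (fpsX _)]. *)
Theorem proposition2p3 (r n : nat) (hr : (1 <= r)%N) (hn : (1 <= n)%N) :
  D r n =
  fps_coef (\prod_(1 <= q < n.+1)
              (1 + fpsC (fpsX rat) * fps_map (@fpsC rat) (exp_quot q)))
           (r - 1).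
Proof.
apply: fpsP => i; rewrite big_add1 /= big_mkord coef_prod_1Dz E_sum -addnBA //.
rewrite (partition_big support_set (fun J : {set 'I_n} => #|J| == i)) /=; last first.
  by move=> f /andP[].
apply: eq_bigr => J /eqP cJ.
rewrite (@coef_prod_exp_quot _ _ _ (i + (r - 1)).+1) cJ addnC //.
apply: eq_bigl => f; rewrite -andbA; congr andb.
by rewrite andb_idl // => /eqP->; rewrite cJ.
Qed.
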